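(* The functions $$\sum_{n\ge0}\frac{(4n)!}{(2n)!\,n!^2}z^n\quad\text{and}\quad\sum_{n\ge0}\Big(\sum_{k=0}^n\binom{n}{k}^6\Big)z^n$$ are algebraically independent over $\mathbb Q(z)$. *)

(* Defs.v *)
From HB Require Import structures.
From mathcomp Require Import all_boot all_order all_algebra.
From mathcomp Require Import boolp.
From mathcomp Require Import fraction mpoly.

Set Implicit Arguments.
Unset Strict Implicit.
Unset Printing Implicit Defensive.

Import GRing.Theory.
Local Open Scope ring_scope.
Local Open Scope quotient_scope.

(* [FPS a] is the series with [z^n]-coefficient [a n]. *)
Record fps (R : Type) := FPS { fps_coef : nat -> R }.

Section FpsRing.
Variable R : idomainType.
Implicit Types f g h : fps R.

HB.instance Definition _ := gen_eqMixin (fps R).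
HB.instance Definition _ := gen_choiceMixin (fps R).

Lemma fpsP f g : fps_coef f =1 fps_coef g -> f = g.
Proof. by case: f => a; case: g => b /= /funext ->. Qed.

Definition fps_const (c : R) : fps R := FPS (fun n => if n is 0 then c else 0).
Definition fps_opp f := FPS (fun n => - fps_coef f n).
Definition fps_add f g := FPS (fun n => fps_coef f n + fps_coef g n).
Definition fps_mul f g :=
  FPS (fun n => \sum_(i < n.+1) fps_coef f i * fps_coef g (n - i)%N).

Lemma fps_addA : associative fps_add.
Proof. by move=> f g h; apply: fpsP => n /=; rewrite addrA. Qed.
Lemma fps_addC : commutative fps_add.
Proof. by move=> f g; apply: fpsP => n /=; rewrite addrC. Qed.
Lemma fps_add0 : left_id (fps_const 0) fps_add.
Proof. by move=> f; apply: fpsP => -[|n] /=; rewrite add0r. Qed.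
Lemma fps_addN : left_inverse (fps_const 0) fps_opp fps_add.
Proof. by move=> f; apply: fpsP => -[|n] /=; rewrite addNr. Qed.

HB.instance Definition _ :=
  GRing.isZmodule.Build (fps R) fps_addA fps_addC fps_add0 fps_addN.

Definition fps_trunc n f : {poly R} := \poly_(i < n.+1) fps_coef f i.

Lemma coef_fps_trunc n f i : (i <= n)%N -> (fps_trunc n f)`_i = fps_coef f i.
Proof. by move=> le_in; rewrite coef_poly ltnS le_in. Qed.

Lemma fps_coef_mul_trunc n f g i : (i <= n)%N ->
  fps_coef (fps_mul f g) i = (fps_trunc n f * fps_trunc n g)`_i.
Proof.
move=> le_in; rewrite coefM /=; apply: eq_bigr => j _.
rewrite !coef_fps_trunc //; first exact: leq_trans (leq_subr _ _) le_in.
by apply: leq_trans le_in; rewrite -ltnS ltn_ord.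
Qed.

Lemma fps_mulA : associative fps_mul.
Proof.
move=> f g h; apply: fpsP => n.
transitivity (fps_trunc n f * fps_trunc n g * fps_trunc n h)`_n.
  rewrite -mulrA coefM /=; apply: eq_bigr => i _.
  rewrite coef_fps_trunc -1?ltnS //; congr (_ * _).
  exact: fps_coef_mul_trunc (leq_subr _ _).
rewrite coefM /=; apply: eq_bigr => i _.
rewrite [in RHS]/= coef_fps_trunc ?leq_subr //; congr (_ * _).
by rewrite -fps_coef_mul_trunc // -ltnS.
Qed.

Lemma fps_mulC : commutative fps_mul.
Proof.
by move=> f g; apply: fpsP => n; rewrite !(fps_coef_mul_trunc _ _ (leqnn n)) mulrC.
Qed.

Lemma fps_mul1 : left_id (fps_const 1) fps_mul.
Proof.
move=> f; apply: fpsP => n /=; rewrite big_ord_recl /= mul1r subn0.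
by rewrite big1 ?addr0 // => i _; rewrite mul0r.
Qed.

Lemma fps_mulDl : left_distributive fps_mul +%R.
Proof.
move=> f g h; apply: fpsP => n /=; rewrite -big_split /=.
by apply: eq_bigr => i _; rewrite mulrDl.
Qed.

Lemma fps_const1_neq0 : fps_const 1 != 0.
Proof.
apply/eqP => /(congr1 (@fps_coef R)) /(congr1 (@^~ 0%N)) /= /eqP.
by rewrite oner_eq0.
Qed.

HB.instance Definition _ := GRing.Zmodule_isComNzRing.Build (fps R)
  fps_mulA fps_mulC fps_mul1 fps_mulDl fps_const1_neq0.

Definition fps_unit : pred (fps R) := fun f => `[< exists g, g * f = 1 >].
Definition fps_inv f : fps R :=
  if pselect (exists g, g * f = 1) is left fV then projT1 (cid fV) else f.

Lemma fps_mulVf : {in fps_unit, left_inverse 1 fps_inv *%R}.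
Proof.
by move=> f /asboolP fV; rewrite /fps_inv; case: pselect => // ?; case: cid.
Qed.

Lemma fps_unitP f g : g * f = 1 -> fps_unit f.
Proof. by move=> gf1; apply/asboolP; exists g. Qed.

Lemma fps_inv_out : {in [predC fps_unit], fps_inv =1 id}.
Proof.
by move=> f /asboolP fNV; rewrite /fps_inv; case: pselect.
Qed.

HB.instance Definition _ := GRing.ComNzRing_hasMulInverse.Build (fps R)
  fps_mulVf fps_unitP fps_inv_out.

Lemma fps_neq0_order f : f != 0 ->
  exists m, fps_coef f m != 0 /\ forall i, (i < m)%N -> fps_coef f i = 0.
Proof.
move=> f0; have exf : exists m, fps_coef f m != 0.
  apply: contra_notP (negP f0) => /forallNP fz; apply/eqP/fpsP => n.
  by have /negP/negPn/eqP -> := fz n; case: n.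
exists (ex_minn exf); case: ex_minnP => m fm min_m; split=> // i lt_im.
by apply/eqP; apply: contraTT lt_im => /min_m; rewrite -leqNgt.
Qed.

Lemma fps_mulf_eq0 f g : f * g = 0 -> (f == 0) || (g == 0).
Proof.
move=> fg0; apply: contra_eqT fg0; rewrite negb_or => /andP[].
move=> /fps_neq0_order [m [fm fz]] /fps_neq0_order [n [gn gz]].
apply/eqP => /(congr1 (@fps_coef R)) /(congr1 (@^~ (m + n)%N)).
have m_lt : (m < (m + n).+1)%N by rewrite ltnS leq_addr.
have -> : fps_coef 0 (m + n)%N = 0 :> R by case: (m + n)%N.
rewrite /= (bigD1 (Ordinal m_lt)) //= addKn big1 ?addr0 => [|i neq_im].
  by apply/eqP; rewrite mulf_neq0.
have [lt_im|] := ltnP i m; first by rewrite fz // mul0r.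
rewrite leq_eqVlt eq_sym => /orP[/eqP eq_im|lt_mi].
  by case/eqP: neq_im; apply: val_inj.
have le_i : (i <= m + n)%N by rewrite -ltnS.
by rewrite gz ?mulr0 // ltn_subLR // ltn_add2r.
Qed.

HB.instance Definition _ :=
  GRing.ComUnitRing_isIntegral.Build (fps R) fps_mulf_eq0.

End FpsRing.

Section RationalFunctions.
Variable R : idomainType.

Definition fps_of_poly (p : {poly R}) : fps R := FPS (fun n => p`_n).

Lemma fps_of_poly_is_zmod_morphism : zmod_morphism fps_of_poly.
Proof. by move=> p q; apply: fpsP => n /=; rewrite coefB. Qed.

Lemma fps_of_poly_is_monoid_morphism : monoid_morphism fps_of_poly.
Proof.
split=> [|p q]; apply: fpsP => n /=; last by rewrite coefM.
by rewrite coef1; case: n.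
Qed.

HB.instance Definition _ := GRing.isZmodMorphism.Build {poly R} (fps R)
  fps_of_poly fps_of_poly_is_zmod_morphism.
HB.instance Definition _ := GRing.isMonoidMorphism.Build {poly R} (fps R)
  fps_of_poly fps_of_poly_is_monoid_morphism.

Lemma fps_of_poly_inj : injective fps_of_poly.
Proof.
move=> p q eq_pq; apply/polyP => i.
by have /= := congr1 (fun f : fps R => fps_coef f i) eq_pq.
Qed.

Local Notation "x %:F" := (tofrac x).

Lemma fps_of_poly_frac_neq0 p : p != 0 -> (fps_of_poly p)%:F != 0.
Proof.
by rewrite tofrac_eq0 -(inj_eq fps_of_poly_inj) (rmorph0 fps_of_poly).
Qed.

Lemma frac_numden (x : {fraction {poly R}}) :
  x = (\n_(repr x))%:F / (\d_(repr x))%:F.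
Proof.
rewrite -[LHS]reprK -[X in \pi X]Ratio_numden.
have d0 := denom_ratioP (repr x); move: (\n_(repr x)) (\d_(repr x)) d0 => n d d0.
unlock FracField.tofrac; rewrite -[X in _ * X]FracField.pi_inv -[RHS]FracField.pi_mul.
rewrite /FracField.mulf /FracField.invf /= !numden_Ratio ?oner_neq0 //.
by rewrite mulr1 mul1r.
Qed.

(* The inclusion of R(z) in the fraction field of R[[z]], which is the field
   R((z)) of formal Laurent series when R is a field. It does not depend on the
   representative of the fraction: see [laurent_of_ratfun_div]. *)
Definition laurent_of_ratfun (x : {fraction {poly R}}) : {fraction (fps R)} :=
  (fps_of_poly \n_(repr x))%:F / (fps_of_poly \d_(repr x))%:F.

Lemma laurent_of_ratfun_div p q : q != 0 ->
  laurent_of_ratfun (p%:F / q%:F) = (fps_of_poly p)%:F / (fps_of_poly q)%:F.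
Proof.
move=> q0; set x := p%:F / q%:F; rewrite /laurent_of_ratfun.
have d0 : \d_(repr x) != 0 by apply: denom_ratioP.
have xE := frac_numden x; move: (\n_(repr x)) (\d_(repr x)) d0 xE => n d d0 /eqP.
rewrite /x eqr_div ?tofrac_eq0 // -!tofracM tofrac_eq => /eqP eq_pd.
apply/eqP; rewrite eqr_div ?fps_of_poly_frac_neq0 //.
by rewrite -!tofracM -!(rmorphM fps_of_poly) tofrac_eq (inj_eq fps_of_poly_inj) eq_pd.
Qed.

Lemma laurent_of_ratfun_is_zmod_morphism : zmod_morphism laurent_of_ratfun.
Proof.
move=> x y; rewrite [in LHS](frac_numden x) [in LHS](frac_numden y).
have := denom_ratioP (repr x); have := denom_ratioP (repr y).
rewrite /(laurent_of_ratfun x) /(laurent_of_ratfun y).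
move: (\n_(repr x)) (\d_(repr x)) (\n_(repr y)) (\d_(repr y)) => a b c d d0 b0.
rewrite -mulNr addf_div ?tofrac_eq0 // -tofracN -!tofracM -tofracD.
rewrite laurent_of_ratfun_div ?mulf_neq0 //.
rewrite -[in RHS]mulNr [RHS]addf_div ?fps_of_poly_frac_neq0 //.
by rewrite -tofracN -!tofracM -tofracD !(rmorphD, rmorphN, rmorphM).
Qed.

Lemma laurent_of_ratfun_is_monoid_morphism : monoid_morphism laurent_of_ratfun.
Proof.
split=> [|x y].
  rewrite -[1 in LHS](divr1 1) -tofrac1 laurent_of_ratfun_div ?oner_neq0 //.
  by rewrite rmorph1 tofrac1 divr1.
rewrite [in LHS](frac_numden x) [in LHS](frac_numden y).
have := denom_ratioP (repr x); have := denom_ratioP (repr y).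
rewrite /(laurent_of_ratfun x) /(laurent_of_ratfun y).
move: (\n_(repr x)) (\d_(repr x)) (\n_(repr y)) (\d_(repr y)) => a b c d d0 b0.
rewrite mulf_div -!tofracM laurent_of_ratfun_div ?mulf_neq0 //.
by rewrite [RHS]mulf_div -!tofracM !rmorphM.
Qed.

HB.instance Definition _ := GRing.isZmodMorphism.Build
  {fraction {poly R}} {fraction (fps R)}
  laurent_of_ratfun laurent_of_ratfun_is_zmod_morphism.
HB.instance Definition _ := GRing.isMonoidMorphism.Build
  {fraction {poly R}} {fraction (fps R)}
  laurent_of_ratfun laurent_of_ratfun_is_monoid_morphism.

End RationalFunctions.

(* [L] is regarded as an extension of [K] through [iota]; [mmap iota h P] is
   the value in [L] of [P] at the family [h]. *)
Definition algebraically_independent (K L : fieldType) (iota : {rmorphism K -> L})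
    (s : seq L) : Prop :=
  forall P : {mpoly K[size s]},
    mmap iota (fun i : 'I_(size s) => s`_i) P = 0 -> P = 0.

(* Main.v *)
Require Import Defs.
From HB Require Import structures.
From mathcomp Require Import all_boot all_order all_algebra.
From mathcomp Require Import fraction.
From mathcomp Require Import boolp mpoly zify ring.

Set Implicit Arguments.
Unset Strict Implicit.
Unset Printing Implicit Defensive.

Import Num.Theory GRing.Theory.
Local Open Scope ring_scope.

(* Write f and g for the two series. Their coefficients satisfy Lucas congruences
   modulo every prime p, so f = A_p(z) f(z^p) and g = B_p(z) g(z^p) in F_p[[z]], where
   A_p and B_p are the truncations of f and g at z^p.

   Let sum_i c_i(z) f^(a_i) g^(b_i) = 0 be a relation over Z[z] with the fewest terms,
   and let p be large. Substituting the congruences and taking, for each r < p, the part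
   supported on exponents congruent to r mod p (Cartier operators) yields new relations
   mod p, of degree bounded independently of p. Relations of bounded degree with fewer
   terms do not exist mod p, so each of the new relations is proportional to the old one.
   Putting the parts together,
     c_i A_p^(a_i) B_p^(b_i) c_j(z^p) = c_j A_p^(a_j) B_p^(b_j) c_i(z^p)   in F_p[z],
   and hence, with a = a_i - a_j, b = b_i - b_j and d = deg c_i - deg c_j,
     a deg A_p + b deg B_p = (p - 1) d   for all large p.

   If p = 7 mod 12, then deg A_p = (p - 3)/4 and deg B_p = 5(p - 1)/6, and a large such
   p forces a = 0 and 5b = 6d. If p = 5 mod 6, then 6b deg B_p = 5b(p - 1) with p - 1
   prime to 3, so b = 0, and the terms i and j are the same. *)

(** * Sections and dilations of power series *)

Section Sections.
Variables (R : idomainType) (p : nat).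
Hypothesis p_gt0 : (0 < p)%N.
Implicit Types f g : fps R.

(** For [p] prime and [R] the field with [p] elements, these are the Cartier operators. *)
Definition fps_sect r f : fps R := FPS (fun n => fps_coef f (n * p + r)%N).

Definition fps_dil f : fps R :=
  FPS (fun n => if (p %| n)%N then fps_coef f (n %/ p)%N else 0).

Lemma fps_coef0 n : fps_coef (0 : fps R) n = 0.
Proof. by case: n. Qed.

Lemma fps_coef1 n : fps_coef (1 : fps R) n = (n == 0%N)%:R.
Proof. by case: n. Qed.

Lemma fps_coefD f g n : fps_coef (f + g) n = fps_coef f n + fps_coef g n.
Proof. by []. Qed.

Lemma fps_coef_sum (I : Type) (r : seq I) (P : pred I) (F : I -> fps R) n :
  fps_coef (\sum_(i <- r | P i) F i) n = \sum_(i <- r | P i) fps_coef (F i) n.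
Proof.
by elim/big_rec2: _ => [|i x y _ <-]; rewrite ?fps_coef0 ?fps_coefD.
Qed.

Lemma fps_sect_sum (I : Type) (s : seq I) (P : pred I) (F : I -> fps R) r :
  fps_sect r (\sum_(i <- s | P i) F i) = \sum_(i <- s | P i) fps_sect r (F i).
Proof. by apply: fpsP => n; rewrite /= !fps_coef_sum. Qed.

Lemma fps_sect0 r : fps_sect r 0 = 0.
Proof. by apply: fpsP => n; rewrite fps_coef0; apply: fps_coef0. Qed.

Lemma fps_sectP f g : (forall r, (r < p)%N -> fps_sect r f = fps_sect r g) -> f = g.
Proof.
move=> eq_fg; apply: fpsP => n; rewrite (divn_eq n p).
have /eq_fg/(congr1 (fun h => fps_coef h (n %/ p)%N)) // : (n %% p < p)%N.
by rewrite ltn_mod.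
Qed.

(** Multiplying by a series in z^p preserves residue classes of exponents, so sections are linear
    over such series. *)
Lemma fps_sect_mul_dil r f g : (r < p)%N ->
  fps_sect r (f * fps_dil g) = fps_sect r f * g.
Proof.
move=> lt_rp; rewrite [f * _]mulrC [RHS]mulrC; apply: fpsP => n /=.
(* Padding the convolution with zeros splits it into [n.+1] blocks of length [p]; only the first
   index [j * p] of a block meets the support of [fps_dil g]. *)
have widen : (n * p + r < n.+1 * p)%N by nia.
pose F i := (if (p %| i)%N then fps_coef g (i %/ p)%N else 0)
              * fps_coef f (n * p + r - i)%N.
rewrite -(big_mkord xpredT F) (big_nat_widen _ _ _ _ _ widen) big_mkcond /=.
rewrite big_nat_mul big_mkord; apply: eq_bigr => j _.
have lt_j := ltn_ord j.
rewrite big_ltn; last by nia.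
have -> : (j * p < (n * p + r).+1)%N by nia.
rewrite big_nat_cond big1 => [|i /andP[/andP[lt1 lt2] _]].
  rewrite /F dvdn_mull // mulnK //= addr0; congr (_ * fps_coef f _).
  by rewrite mulnBl; nia.
case: ifP => // _; rewrite /F; case: ifP; rewrite ?mul0r // => /dvdnP[q Eq].
by move: lt1 lt2; rewrite Eq !ltn_pmul2r // ltnS ltnNge => /negbTE ->.
Qed.

Lemma fps_sect1 r : (r < p)%N -> fps_sect r 1 = (r == 0%N)%:R.
Proof.
move=> lt_rp; apply: fpsP => n; rewrite [LHS]fps_coef1.
case: r lt_rp => [|r] lt_rp; last by rewrite addnS fps_coef0.
by rewrite fps_coef1 addn0 muln_eq0 [p == _]gtn_eqF // orbF.
Qed.

Lemma fps_sect_dil r g : (r < p)%N -> fps_sect r (fps_dil g) = (r == 0%N)%:R * g.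
Proof.
by move=> lt_rp; rewrite -[fps_dil g]mul1r fps_sect_mul_dil // fps_sect1.
Qed.

(** Compared section by section: on both sides only the section at 0 survives. *)
Lemma fps_dil_is_monoid_morphism : monoid_morphism fps_dil.
Proof.
split=> [|f g]; apply: fps_sectP => r lt_rp.
  by rewrite fps_sect_dil // mulr1 fps_sect1.
by rewrite fps_sect_mul_dil // !fps_sect_dil // mulrA.
Qed.

Lemma fps_dilM f g : fps_dil (f * g) = fps_dil f * fps_dil g.
Proof. exact: fps_dil_is_monoid_morphism.2. Qed.

Lemma fps_dilX f n : fps_dil (f ^+ n) = fps_dil f ^+ n.
Proof.
elim: n => [|n IHn]; first exact: fps_dil_is_monoid_morphism.1.
by rewrite !exprS fps_dilM IHn.
Qed.

Lemma fps_dil_poly (q : {poly R}) :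
  fps_dil (fps_of_poly q) = fps_of_poly (q \Po 'X^p).
Proof.
apply: fpsP => n /=; rewrite coef_comp_poly_Xn //.
Qed.

End Sections.

(** * Lucas congruences *)

(** This is (4n)!/((2n)! n!^2); as a product of central binomials it is visibly an integer and
    inherits their Lucas congruences. *)
Definition fnat n := ('C((n.*2).*2, n.*2) * 'C(n.*2, n))%N.
Definition gnat n := (\sum_(0 <= k < n.+1) 'C(n, k) ^ 6)%N.
Definition ffps (R : idomainType) : fps R := FPS (fun n => (fnat n)%:R).
Definition gfps (R : idomainType) : fps R := FPS (fun n => (gnat n)%:R).

Lemma gnat_widen n m : (n < m)%N -> gnat n = (\sum_(0 <= k < m) 'C(n, k) ^ 6)%N.
Proof.
move=> lt_nm; rewrite /gnat (big_nat_widen _ _ _ _ _ lt_nm) big_mkcond.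
by apply: eq_bigr => k _ /=; rewrite ltnS; case: leqP => // /bin_small ->.
Qed.

Section Lucas.
Variables (R : idomainType) (p : nat).
Hypothesis charRp : p \in [pchar R].

Let p_pr : prime p. Proof. exact: pcharf_prime charRp. Qed.
Let p_gt0 : (0 < p)%N. Proof. exact: prime_gt0. Qed.

Lemma fps_sect_small r (q : {poly R}) : (r < p)%N -> (size q <= p)%N ->
  fps_sect p r (fps_of_poly q) = fps_of_poly (q`_r)%:P.
Proof.
move=> lt_rp size_q; apply: fpsP => -[|n]; rewrite /= coefC //=.
by rewrite nth_default // (leq_trans size_q) // mulSn -addnA leq_addr.
Qed.

Lemma fps_of_polyC_mul c (f : fps R) n :
  fps_coef (fps_of_poly c%:P * f) n = c * fps_coef f n.
Proof.
rewrite /= big_ord_recl /= coefC subn0 big1 ?addr0 // => i _.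
by rewrite coefC mul0r.
Qed.

(** The hypothesis at [r] is exactly section [r] of the functional equation. *)
Lemma lucas_fps (u : nat -> R) :
    (forall n r, (r < p)%N -> u (n * p + r)%N = u n * u r) ->
  FPS u = fps_of_poly (\poly_(i < p) u i) * fps_dil p (FPS u).
Proof.
move=> uP; apply: (fps_sectP p_gt0) => r lt_rp.
rewrite fps_sect_mul_dil // fps_sect_small ?size_poly // coef_poly lt_rp.
by apply: fpsP => n; rewrite fps_of_polyC_mul mulrC; apply: uP.
Qed.

Lemma coef_expXD1 n k : (('X + 1 : {poly R}) ^+ n)`_k = 'C(n, k)%:R.
Proof.
rewrite exprD1n coef_sum.
have [lt_kn|le_nk] := ltnP k n.+1; last first.
  rewrite bin_small // big1 // => i _; rewrite coefMn coefXn.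
  by rewrite gtn_eqF ?mul0rn // (leq_trans _ le_nk).
rewrite (bigD1 (Ordinal lt_kn)) //= coefMn coefXn eqxx big1 ?addr0 // => i.
by rewrite -val_eqE /= => ne_ik; rewrite coefMn coefXn eq_sym (negbTE ne_ik) mul0rn.
Qed.

Lemma size_expXD1 n : size (('X + 1 : {poly R}) ^+ n) = n.+1.
Proof. by rewrite -[1]opprK -(rmorphN1 polyC) size_exp_XsubC. Qed.

(** Lucas' theorem: take section [s] of (X + 1)^(np+r) = (X + 1)^r (X^p + 1)^n. *)
Lemma bin_lucas n k r s : (r < p)%N -> (s < p)%N ->
  'C(n * p + r, k * p + s)%:R = 'C(n, k)%:R * 'C(r, s)%:R :> R.
Proof.
move=> lt_rp lt_sp; pose W m := fps_of_poly (('X + 1 : {poly R}) ^+ m).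
have W_eq : W (n * p + r)%N = W r * fps_dil p (W n).
  rewrite /W fps_dil_poly // -rmorphM; congr fps_of_poly.
  rewrite rmorphXn /= comp_polyD comp_polyX comp_polyC mulrC exprD mulnC exprM.
  congr (_ ^+ _ * _); rewrite exprDn_pchar ?expr1n //.
  by rewrite (eq_pnat _ (pchar_poly R)) (eq_pnat _ (pcharf_eq charRp)) pnat_id.
have : fps_coef (fps_sect p s (W (n * p + r)%N)) k
     = fps_coef (fps_sect p s (W r * fps_dil p (W n))) k by rewrite W_eq.
rewrite fps_sect_mul_dil // [fps_sect p s (W r)]fps_sect_small ?size_expXD1 //.
rewrite fps_of_polyC_mul /=.
by rewrite !coef_expXD1 mulrC.
Qed.

(** If 2r < p there is no carry. Otherwise the last digit of 2r is 2r - p < r, and both sides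
    vanish. *)
Lemma central_bin_lucas n r : (r < p)%N ->
  'C((n * p + r).*2, n * p + r)%:R = 'C(n.*2, n)%:R * 'C(r.*2, r)%:R :> R.
Proof.
move=> lt_rp; have [lt_2r|le_p2r] := ltnP r.*2 p.
  by rewrite doubleD doubleMl bin_lucas.
have lt_rp' : (r.*2 - p < p)%N by lia.
have C0 : 'C(r.*2 - p, r) = 0%N by apply: bin_small; lia.
have -> : 'C(r.*2, r)%:R = 0 :> R.
  have {1}-> : (r.*2 = 1 * p + (r.*2 - p))%N by lia.
  have {2}-> : (r = 0 * p + r)%N by [].
  by rewrite bin_lucas // C0 mulr0.
have -> : ((n * p + r).*2 = n.*2.+1 * p + (r.*2 - p))%N by nia.
by rewrite bin_lucas // C0 !mulr0.
Qed.

Lemma dvdn_central_bin r : (r < p)%N -> (p <= r.*2)%N -> (p %| 'C(r.*2, r))%N.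
Proof.
move=> lt_rp le_p2r; rewrite (dvdn_pcharf charRp).
have {1}-> : (r.*2 = 1 * p + (r.*2 - p))%N by lia.
have {2}-> : (r = 0 * p + r)%N by [].
by rewrite bin_lucas ?[X in _ * X%:R]bin_small ?mulr0 //; lia.
Qed.

Lemma fnat_lucas n r : (r < p)%N ->
  (fnat (n * p + r))%:R = (fnat n)%:R * (fnat r)%:R :> R.
Proof.
move=> lt_rp; rewrite /fnat !natrM central_bin_lucas //.
have [lt_2r|le_p2r] := ltnP r.*2 p.
  have -> : ((n * p + r).*2 = n.*2 * p + r.*2)%N by lia.
  by rewrite central_bin_lucas // mulrACA.
(* Both sides contain the factor ['C(r.*2, r)], which is zero here. *)
have := dvdn_central_bin lt_rp le_p2r; rewrite (dvdn_pcharf charRp) => /eqP ->.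
by rewrite !mulr0.
Qed.

(** Extended to k < (n+1)p, the sum splits into blocks k = ip + s, where Lucas' theorem factors each
    term. *)
Lemma gnat_lucas n r : (r < p)%N ->
  (gnat (n * p + r))%:R = (gnat n)%:R * (gnat r)%:R :> R.
Proof.
move=> lt_rp; rewrite (@gnat_widen _ (n.+1 * p)); last by nia.
rewrite (gnat_widen lt_rp) /gnat big_nat_mul !natr_sum mulr_suml.
apply: eq_bigr => i _; rewrite natr_sum mulr_sumr.
rewrite -[X in index_iota X _]add0n big_addn mulSn addnK.
apply: eq_big_nat => k /andP[_ lt_kp].
by rewrite [(k + _)%N]addnC !natrX bin_lucas // exprMn.
Qed.

End Lucas.

(** * Degrees of the truncations modulo a prime *)

Lemma size_poly_last (R : nzRingType) (E : nat -> R) m n :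
    (n < m)%N -> E n != 0 -> (forall i, (n < i < m)%N -> E i = 0) ->
  size (\poly_(i < m) E i) = n.+1.
Proof.
move=> lt_nm En E0; apply/anti_leq/andP; split.
  apply/leq_sizeP => i lt_ni; rewrite coef_poly; case: ifP => // lt_im.
  by rewrite E0 ?lt_ni.
rewrite ltnNge; apply: contra En => /leq_sizeP/(_ n (leqnn n)).
by rewrite coef_poly lt_nm => ->.
Qed.

Section Degrees.
Variables (R : idomainType) (p : nat).
Hypothesis charRp : p \in [pchar R].

Let p_pr : prime p. Proof. exact: pcharf_prime charRp. Qed.
Let p_gt0 : (0 < p)%N. Proof. exact: prime_gt0. Qed.

Lemma natr_lt_char_neq0 n : (0 < n < p)%N -> n%:R != 0 :> R.
Proof. by case/andP=> n_gt0 lt_np; rewrite -(dvdn_pcharf charRp) gtnNdvd. Qed.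

Lemma fact_lt_char_neq0 n : (n < p)%N -> n`!%:R != 0 :> R.
Proof.
elim: n => [|n IHn] lt_np; first by rewrite fact0 oner_eq0.
rewrite factS natrM mulf_neq0 //; first exact: natr_lt_char_neq0.
exact/IHn/ltnW.
Qed.

Lemma bin_lt_char_neq0 n k : (k <= n)%N -> (n < p)%N -> 'C(n, k)%:R != 0 :> R.
Proof.
move=> le_kn /fact_lt_char_neq0; rewrite -(bin_fact le_kn) natrM mulf_eq0.
by rewrite negb_or => /andP[].
Qed.

(** If s < p <= 2s, then p divides C(2s, s); this is applied with s = 2r when 2r < p, and with s = r
    otherwise. If 4r < p, no factorial involved is divisible by p. *)
Lemma fnat_char_eq0 r : (r < p)%N -> ((fnat r)%:R == 0 :> R) = (p <= 4 * r)%N.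
Proof.
move=> lt_rp; rewrite /fnat natrM mulf_eq0; have [le_p4r|lt_4r] := leqP p (4 * r)%N.
  rewrite -!(dvdn_pcharf charRp); have [lt_2r|le_p2r] := ltnP r.*2 p.
    by rewrite (dvdn_central_bin charRp) //; lia.
  by rewrite [X in _ || X](dvdn_central_bin charRp) ?orbT.
by apply/negbTE; rewrite negb_or !bin_lt_char_neq0 //; lia.
Qed.

Definition ftrunc : {poly R} := \poly_(i < p) (fnat i)%:R.
Definition gtrunc : {poly R} := \poly_(i < p) (gnat i)%:R.

Lemma size_ftrunc : (p %% 4 = 3)%N -> (4 * (size ftrunc) = p + 1)%N.
Proof.
move=> p3; have := prime_gt1 p_pr => p_gt1.
rewrite (@size_poly_last _ _ _ (p %/ 4)) //; first by lia.
- by lia.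
- by rewrite fnat_char_eq0 -?ltnNge; lia.
by move=> i lt_i; apply/eqP; rewrite fnat_char_eq0; lia.
Qed.

(* Telescoping k^(d+1) gives a recursion whose leading coefficient d+1 is invertible. *)
Lemma power_sum_char d : (d.+1 < p)%N -> \sum_(0 <= k < p) k%:R ^+ d = 0 :> R.
Proof.
have [n] := ubnP d; elim: n d => // n IHn d le_dn lt_dp.
have tele : \sum_(0 <= k < p) ((k.+1)%:R ^+ d.+1 - k%:R ^+ d.+1) = 0 :> R.
  by rewrite telescope_sumr // (pcharf0 charRp) !expr0n subr0.
have expand (k : nat) : (k.+1)%:R ^+ d.+1 - k%:R ^+ d.+1
    = \sum_(i < d.+1) k%:R ^+ i *+ 'C(d.+1, i) :> R.
  by rewrite -natr1 exprD1n big_ord_recr /= binn mulr1n addrK.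
move: tele; under eq_bigr do rewrite expand.
rewrite exchange_big big_ord_recr /= big1 ?add0r => [|i _].
  rewrite sumrMnl binSn -mulr_natr => /eqP.
  by rewrite mulf_eq0 (negbTE (natr_lt_char_neq0 _)) ?orbF // => /eqP.
by rewrite sumrMnl IHn ?mul0rn //; have := ltn_ord i; lia.
Qed.

(** By Fermat each of the p - 1 nonzero terms is 1, and p - 1 = -1 in [R]. *)
Lemma power_sum_char_pred : \sum_(0 <= k < p) k%:R ^+ p.-1 = -1 :> R.
Proof.
have -> : p.-1 = p.-2.+1 by have := prime_gt1 p_pr; lia.
rewrite big_ltn // expr0n add0r.
rewrite (eq_big_nat _ _ (F2 := fun=> 1)) => [|k k_lt]; last first.
  have k0 := natr_lt_char_neq0 k_lt; apply: (mulfI k0).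
  rewrite mulr1 -exprS; have -> : p.-2.+2 = p by have := prime_gt1 p_pr; lia.
  exact: (pFrobenius_aut_nat charRp).
by rewrite sumr_const_nat natrB // (pcharf0 charRp) add0r.
Qed.

Lemma sum_horner_char (q : {poly R}) : (size q <= p)%N ->
  \sum_(0 <= k < p) q.[k%:R] = - q`_p.-1.
Proof.
move=> size_q; under eq_bigr do rewrite (horner_coef_wide _ size_q).
rewrite exchange_big /= -[in LHS](prednK p_gt0) big_ord_recr /= prednK //.
rewrite -mulr_sumr power_sum_char_pred mulrN1 big1 ?add0r // => i _.
by rewrite -mulr_sumr power_sum_char ?mulr0 //; have := ltn_ord i; lia.
Qed.

(** Since p - 1 - m = -1 - m in [R], this is the identity C(-1-m, k) = (-1)^k C(m+k, k); [k + m < p]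
    keeps the denominators invertible. *)
Lemma bin_reflect_char m k : (k + m < p)%N ->
  'C(p.-1 - m, k)%:R = (-1) ^+ k * 'C(m + k, k)%:R :> R.
Proof.
elim: k => [|k IHk] lt_kp; first by rewrite !bin0 mul1r.
have k0 : k.+1%:R != 0 :> R by rewrite natr_lt_char_neq0 //; lia.
apply: (mulfI k0); rewrite -natrM mul_bin_left natrM IHk; last by lia.
have -> : (p.-1 - m - k)%:R = - (m + k).+1%:R :> R.
  by apply/eqP; rewrite -subr_eq0 opprK -natrD -(dvdn_pcharf charRp);
     have -> : (p.-1 - m - k + (m + k).+1 = p)%N by lia.
rewrite [RHS]mulrCA -natrM addnS -mul_bin_diag natrM /= exprS.
by rewrite mulN1r !mulNr mulrCA.
Qed.

(** The even exponent 6 absorbs the sign of [bin_reflect_char]. For k + m >= p both binomials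
    vanish, the right one because of a carry. *)
Lemma gnat_reflect m : (m < p)%N ->
  (gnat (p.-1 - m))%:R = \sum_(0 <= k < p) 'C(m + k, k)%:R ^+ 6 :> R.
Proof.
move=> lt_mp; rewrite (@gnat_widen _ p) ?natr_sum; last by lia.
apply: eq_big_nat => k /andP[_ lt_kp]; rewrite natrX.
have [lt_kmp|le_pkm] := ltnP (k + m) p.
  by rewrite bin_reflect_char // exprMn -exprM mulnC exprM -signr_odd expr1n mul1r.
rewrite bin_small; last by lia.
suff -> : 'C(m + k, k)%:R = 0 :> R by [].
have {1}-> : (m + k = 1 * p + (m + k - p))%N by lia.
have {2}-> : (k = 0 * p + k)%N by [].
rewrite (bin_lucas charRp) ?[X in _ * X%:R]bin_small ?mulr0 //.
all: lia.
Qed.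

(** This is m! C(X + m, m), which makes C(m+k, k) a polynomial in k up to the factor m!. *)
Definition rising m : {poly R} := \prod_(i < m) ('X + (i.+1%:R)%:P).

Lemma rising_monic m : rising m \is monic.
Proof. by apply: monic_prod => i _; rewrite monicE lead_coefXaddC. Qed.

Lemma size_rising m : size (rising m) = m.+1.
Proof.
elim: m => [|m IHm]; first by rewrite /rising big_ord0 size_poly1.
rewrite /rising big_ord_recr /= size_Mmonic ?monicXaddC ?monic_neq0 ?rising_monic //.
by rewrite size_XaddC -/(rising m) IHm addn2.
Qed.

Lemma horner_rising m k :
  (rising m).[k%:R] = m`!%:R * 'C(m + k, k)%:R.
Proof.
elim: m => [|m IHm]; first by rewrite /rising big_ord0 hornerC binn mulr1.
rewrite /rising big_ord_recr /= hornerM -/(rising m) IHm hornerD hornerX hornerC.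
rewrite -natrD -!natrM; congr _%:R; rewrite addSn factS.
have := mul_bin_down (m + k).+1 k; rewrite -addSn addnK addSn /= => E.
by rewrite -mulnA [X in (_ * X)%N]mulnC addnS [(k + m)%N]addnC E mulnCA mulnA.
Qed.

(* Since C(p-1-m, k) = (-1)^k C(m+k, k) in R, the left-hand side is the sum over the
   prime field of a monic polynomial of degree 6m. *)
Lemma gnat_top m : (6 * m <= p.-1)%N ->
  m`!%:R ^+ 6 * (gnat (p.-1 - m))%:R = - (6 * m == p.-1)%:R :> R.
Proof.
move=> le_6m; rewrite gnat_reflect; last by lia.
have size6 : size (rising m ^+ 6) = (6 * m).+1.
  rewrite -[LHS]prednK ?size_exp ?size_rising 1?mulnC // lt0n size_poly_eq0.
  by rewrite expf_neq0 // monic_neq0 // rising_monic.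
rewrite mulr_sumr (eq_bigr (fun k => (rising m ^+ 6).[k%:R])) => [|k _]; last first.
  by rewrite horner_exp horner_rising exprMn.
rewrite sum_horner_char ?size6; last by lia.
congr (- _); case: eqP => [<-|ne].
  have /monicP := monic_exp 6 (rising_monic m).
  by rewrite /lead_coef size6.
by rewrite nth_default // size6; lia.
Qed.

(** By [gnat_top] the coefficient at p - 1 - m vanishes for m < (p-1)/6 but not for m = (p-1)/6, so
    the degree is 5(p-1)/6. *)
Lemma size_gtrunc : (p %% 6 = 1)%N -> (6 * (size gtrunc) = 5 * p + 1)%N.
Proof.
move=> p1; have := prime_gt1 p_pr => p_gt1.
have gtop m : (6 * m <= p.-1)%N -> ((gnat (p.-1 - m))%:R == 0 :> R) = (6 * m != p.-1)%N.
  move=> le_6m; have /eqP := gnat_top le_6m.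
  have m0 : m`!%:R ^+ 6 != 0 :> R by rewrite expf_neq0 // fact_lt_char_neq0 //; lia.
  case: (6 * m == _)%N => /=; last by rewrite oppr0 mulf_eq0 (negbTE m0).
  by apply: contraTF => /eqP ->; rewrite mulr0 eq_sym oppr_eq0 oner_eq0.
rewrite (@size_poly_last _ _ _ (p.-1 - p.-1 %/ 6)) //; first by lia.
- by lia.
- by rewrite gtop; lia.
move=> i /andP[lt_i lt_ip]; apply/eqP; have -> : i = (p.-1 - (p.-1 - i))%N by lia.
by rewrite gtop; lia.
Qed.

Lemma ftrunc_neq0 : ftrunc != 0.
Proof.
apply: contra_neqN (oner_neq0 R) => /eqP/polyP/(_ 0%N).
by rewrite coef_poly p_gt0 coef0 => <-.
Qed.

Lemma gtrunc_neq0 : gtrunc != 0.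
Proof.
apply: contra_neqN (oner_neq0 R) => /eqP/polyP/(_ 0%N).
by rewrite coef_poly p_gt0 coef0 /gnat big_nat1 bin0 exp1n => <-.
Qed.

Lemma ffps_frob : ffps R = fps_of_poly ftrunc * fps_dil p (ffps R).
Proof. by apply: (lucas_fps charRp) => n r; apply: (fnat_lucas charRp). Qed.

Lemma gfps_frob : gfps R = fps_of_poly gtrunc * fps_dil p (gfps R).
Proof. by apply: (lucas_fps charRp) => n r; apply: (gnat_lucas charRp). Qed.

End Degrees.

(** * Primes in arithmetic progressions *)

(** A product of primes congruent to 1 mod [d] is itself congruent to 1. *)
Lemma exists_prime_divisor_neq1_mod d n : (1 < d)%N -> (0 < n)%N -> (n %% d != 1)%N ->
  exists p, [/\ prime p, (p %| n)%N & (p %% d != 1)%N].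
Proof.
move=> d_gt1; have [k] := ubnP n; elim: k n => // k IHk n le_nk n_gt0 nd.
have n_gt1 : (1 < n)%N by case: n n_gt0 nd {le_nk} => [|[|n]] //; rewrite modn_small.
have [p p_pr p_dvd] := pdivP n_gt1.
have [p1|] := eqVneq (p %% d)%N 1%N; last by exists p.
have E := divnK p_dvd; have p_gt1 := prime_gt1 p_pr.
have q_gt0 : (0 < n %/ p)%N by rewrite divn_gt0 ?prime_gt0 // dvdn_leq.
have q_lt : (n %/ p < n)%N by rewrite ltn_Pdiv.
have [|//||r [r_pr r_dvd rd]] := IHk (n %/ p)%N; first by lia.
  by apply: contra nd => /eqP qd; rewrite -E -modnMml qd mul1n p1.
by exists r; split=> //; rewrite -E dvdn_mulr.
Qed.

(** Euclid's argument with 6 B! - 1, which is 5 mod 6 and prime to 6 B!. *)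
Lemma prime_5_mod_6 B : exists p, [/\ prime p, (B < p)%N & (p %% 6 = 5)%N].
Proof.
have F_gt0 := fact_gt0 B; pose n := (6 * B`! - 1)%N.
have [|||p [p_pr p_dvd p6]] := @exists_prime_divisor_neq1_mod 6 n; rewrite /n //; try lia.
have coprime_p m : (m %| 6 * B`!)%N -> (m %| p)%N -> m = 1%N.
  move=> m_dvd /dvdn_trans/(_ p_dvd) m_dvd'; apply/eqP; rewrite -dvdn1.
  by rewrite -(dvdn_addr _ m_dvd') /n subnK //; lia.
exists p; split=> //.
  rewrite ltnNge; apply/negP => le_pB.
  have := coprime_p p; rewrite dvdn_mull ?dvdn_fact ?prime_gt0 // => /(_ isT (dvdnn _)) p1.
  by rewrite p1 in p_pr.
have p2 : ~~ (2 %| p)%N by apply/negP => /coprime_p; rewrite dvdn_mulr // => /(_ isT).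
have p3 : ~~ (3 %| p)%N by apply/negP => /coprime_p; rewrite dvdn_mulr // => /(_ isT).
move: p2 p3 p6; rewrite /dvdn -(@modn_dvdm 6 p 2) // -(@modn_dvdm 6 p 3) //.
by move: (p %% 6)%N (ltn_pmod p (isT : (0 < 6)%N)); do 6?[case=> //].
Qed.

(** The class x of [m] satisfies x^3 = 1. If p = 2 mod 3, then x = x^p = x^2, so x is 0 or 1 and x^2
    + x + 1 is 1 or 3, neither of which is zero. *)
Lemma prime_dvd_cyclotomic3 p m : prime p -> (p %| m ^ 2 + m + 1)%N -> (p %% 3 != 2)%N.
Proof.
move=> p_pr p_dvd; apply/eqP => p3; have charp := pchar_Fp p_pr.
pose x : 'F_p := m%:R.
have x0 : x ^+ 2 + x + 1 = 0.
  have -> : x ^+ 2 + x + 1 = (m ^ 2 + m + 1)%:R by rewrite !natrD natrX.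
  by apply/eqP; rewrite -(dvdn_pcharf charp).
have x3 : x ^+ 3 = 1.
  have fac (y : 'F_p) : y ^+ 3 - 1 = (y - 1) * (y ^+ 2 + y + 1) by ring.
  by apply/eqP; rewrite -subr_eq0 fac x0 mulr0.
have xp : x ^+ p = x by exact: (pFrobenius_aut_nat charp).
move: xp; rewrite [X in x ^+ X](divn_eq p 3) p3 exprD mulnC exprM x3 expr1n mul1r => x2.
have : 3%:R == 0 :> 'F_p.
  have : x * (x - 1) == 0 by rewrite mulrBr mulr1 -expr2 x2 subrr.
  rewrite mulf_eq0 subr_eq0 => /orP[]/eqP xE; move: x0; rewrite xE.
    by rewrite expr0n !add0r => /eqP; rewrite oner_eq0.
  by rewrite expr1n -!natr1 add0r => ->.
rewrite -(dvdn_pcharf charp) dvdn_prime2 // => /eqP p3'; by rewrite p3' in p3.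
Qed.

(** With Q an odd multiple of 3 and m = 2Q, the number m^2 + m + 1 is 7 mod 12. Its prime divisors
    are prime to 6 and not 2 mod 3, hence 1 or 7 mod 12, and some divisor is not 1. *)
Lemma prime_7_mod_12 B : exists p, [/\ prime p, (B < p)%N & (p %% 12 = 7)%N].
Proof.
(* The factors run over the odd numbers up to 2B + 3, so that 3 occurs even for [B = 0]. *)
pose Q := (\prod_(i < B.+2) i.*2.+1)%N.
have odd_dvdQ k : odd k -> (k <= B.*2.+3)%N -> (k %| Q)%N.
  move=> k_odd le_k; have lt_k : (k./2 < B.+2)%N by lia.
  rewrite /Q (bigD1 (Ordinal lt_k)) //= dvdn_mulr //.
  by have -> : (k./2).*2.+1 = k by lia.
have Q_odd : odd Q.
  rewrite /Q; elim/big_ind: _ => // [x y x_odd y_odd|i _]; first by rewrite oddM x_odd.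
  by rewrite /= odd_double.
have Q3 : (3 %| Q)%N by apply: odd_dvdQ; lia.
pose m := Q.*2; pose n := (m ^ 2 + m + 1)%N.
have n12 : (n %% 12 = 7)%N.
  have [q Qq] : exists q, Q = (6 * q + 3)%N by exists (Q %/ 6)%N; lia.
  rewrite /n /m Qq (_ : (_ + 1)%N = (12 * (12 * q ^ 2 + 13 * q + 3) + 7)%N); last by nia.
  by rewrite mulnC modnMDl.
have [|||p [p_pr p_dvd p12]] := @exists_prime_divisor_neq1_mod 12 n; rewrite ?n12 //.
  by rewrite /n addn1.
have p3 := prime_dvd_cyclotomic3 p_pr p_dvd.
have coprime_p k : (k %| m)%N -> (k %| p)%N -> k = 1%N.
  move=> k_dvd /dvdn_trans/(_ p_dvd) k_dvd'; apply/eqP; rewrite -dvdn1.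
  by rewrite /n dvdn_addr // in k_dvd'; rewrite dvdn_addl // dvdn_exp.
have p_2 : odd p.
  rewrite -[odd p]negbK -dvdn2; apply/negP => /coprime_p.
  by rewrite /m -mul2n dvdn_mulr // => /(_ isT).
have p_3 : ~~ (3 %| p)%N.
  by apply/negP => /coprime_p; rewrite /m -mul2n dvdn_mull // => /(_ isT).
have p_12 : (p %% 12 = 7)%N.
  move: p_2 p_3 p3 p12; rewrite -[odd p]negbK -dvdn2 /dvdn.
  rewrite -(@modn_dvdm 12 p 2) // -!(@modn_dvdm 12 p 3) //.
  by move: (p %% 12)%N (ltn_pmod p (isT : (0 < 12)%N)); do 12?[case=> //].
exists p; split=> //.
rewrite ltnNge; apply/negP => le_pB.
have := coprime_p p; rewrite /m -mul2n dvdn_mull ?odd_dvdQ //; last by lia.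
by move=> /(_ isT (dvdnn _)) p1; rewrite p1 in p_pr.
Qed.

(** * Relations modulo large primes *)

Lemma intr_Fp_neq0 p (z : int) : prime p -> z != 0 -> (`|z| < p)%N ->
  z%:~R != 0 :> 'F_p.
Proof.
move=> p_pr z0 lt_zp; rewrite -(dvdz_pcharf (pchar_Fp p_pr)) dvdzE absz_nat.
by rewrite gtnNdvd // absz_gt0.
Qed.

Lemma sum_delta (R : pzSemiRingType) (I : finType) (i0 : I) (F : I -> R) :
  \sum_i (i == i0)%:R * F i = F i0.
Proof.
rewrite (bigD1 i0) //= eqxx mul1r big1 ?addr0 // => i /negbTE ->.
by rewrite mul0r.
Qed.

(* Fraction-free Gaussian elimination: the pivots are finitely many nonzero
   integers, and any prime larger than all of them preserves independence. *)
Lemma lin_indep_mod_prime (I : finType) (A : {set I}) (v : I -> nat -> int) :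
    (forall a : I -> int, (forall i, i \notin A -> a i = 0) ->
       (forall n, \sum_i a i * v i n = 0) -> forall i, a i = 0) ->
  exists B, forall p, prime p -> (B < p)%N ->
    forall a : I -> 'F_p, (forall i, i \notin A -> a i = 0) ->
       (forall n, \sum_i a i * (v i n)%:~R = 0) -> forall i, a i = 0.
Proof.
have [k] := ubnP #|A|; elim: k A v => // k IHk A v le_Ak indep.
have [A0|[i0 Ai0]] := set_0Vmem A.
  by exists 0%N => p _ _ a a_supp _ i; rewrite a_supp // A0 inE.
have [n0 vn0] : exists n, v i0 n != 0.
  apply: contrapT => /forallNP v0.
  have supp i : i \notin A -> (i == i0)%:R = 0 :> int.
    by case: eqP => [->|//]; rewrite Ai0.
  have rel n : \sum_i (i == i0)%:R * v i n = 0.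
    by rewrite sum_delta; have /negP/negPn/eqP -> := v0 n.
  by have /eqP := indep _ supp rel i0; rewrite eqxx oner_eq0.
pose w i n := v i0 n0 * v i n - v i n0 * v i0 n.
have [||B BP] := IHk (A :\ i0) w.
- by move: le_Ak; rewrite (cardsD1 i0) Ai0 add1n.
- move=> b b_supp b_rel.
  (* These are the coefficients, in terms of [v], of the combination of the [w i] with coefficients
     [b]. *)
  pose a i := v i0 n0 * b i - (i == i0)%:R * \sum_j b j * v j n0.
  have a0 : forall i, a i = 0.
    apply: (indep a) => [i Ai|n].
      rewrite /a b_supp ?inE ?(negbTE Ai) ?andbF // mulr0.
      by case: (i =P i0) Ai => [->|_ _]; rewrite ?Ai0 ?mul0r ?subrr.
    transitivity (\sum_i (v i0 n0 * (b i * v i n)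
        - (i == i0)%:R * ((\sum_j b j * v j n0) * v i n))).
      by apply: eq_bigr => i _; rewrite /a; ring.
    rewrite sumrB sum_delta -mulr_sumr -[RHS](b_rel n) mulr_sumr mulr_suml -sumrB.
    by apply: eq_bigr => i _; rewrite /w; ring.
  move=> i; have [->|ne_i] := eqVneq i i0; first by rewrite b_supp // !inE eqxx.
  have /eqP := a0 i; rewrite /a (negbTE ne_i) mul0r subr0 mulf_eq0 (negbTE vn0).
  by move/eqP.
exists (maxn B `|v i0 n0|) => p p_pr; rewrite gtn_max => /andP[lt_B lt_v] a a_supp a_rel.
have v_neq0 := intr_Fp_neq0 p_pr vn0 lt_v.
have aN0 i : i != i0 -> a i = 0.
  move=> ne_i; suff /(_ i) : forall i, (i != i0)%:R * a i = 0 by rewrite ne_i mul1r.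
  apply: (BP p p_pr lt_B (fun i => (i != i0)%:R * a i)) => {ne_i}[j|n].
    by rewrite !inE negb_and negbK => /orP[->|/a_supp ->]; rewrite ?mul0r ?mulr0.
  transitivity ((v i0 n0)%:~R * (\sum_j a j * (v j n)%:~R)
     - (\sum_j a j * (v j n0)%:~R) * (v i0 n)%:~R).
    rewrite mulr_sumr mulr_suml -sumrB; apply: eq_bigr => j _.
    have [->|_] := eqVneq j i0; first by rewrite !mul0r; ring.
    by rewrite mul1r /w rmorphB !rmorphM /=; ring.
  by rewrite !a_rel mul0r mulr0 subrr.
move=> i; have [->|/aN0 //] := eqVneq i i0; have := a_rel n0.
rewrite (bigD1 i0) //= big1 ?addr0 => [|j /aN0 ->]; last by rewrite mul0r.
by move/eqP; rewrite mulf_eq0 (negbTE v_neq0) orbF => /eqP.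
Qed.

(** * Base change of power series and monomials in f and g *)

Section FpsMap.
Variables (R S : idomainType) (h : {rmorphism R -> S}).

Definition fps_map (f : fps R) : fps S := FPS (fun n => h (fps_coef f n)).

Lemma fps_map_is_zmod_morphism : zmod_morphism fps_map.
Proof. by move=> f g; apply: fpsP => n; rewrite /= rmorphB. Qed.

Lemma fps_map_is_monoid_morphism : monoid_morphism fps_map.
Proof.
split=> [|f g]; apply: fpsP => n.
  by rewrite -[LHS]/(h (fps_coef 1 n)) !fps_coef1 rmorph_nat.
by rewrite /= rmorph_sum; apply: eq_bigr => i _; rewrite rmorphM.
Qed.

HB.instance Definition _ := GRing.isZmodMorphism.Build (fps R) (fps S)
  fps_map fps_map_is_zmod_morphism.
HB.instance Definition _ := GRing.isMonoidMorphism.Build (fps R) (fps S)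
  fps_map fps_map_is_monoid_morphism.

Lemma fps_map_poly q : fps_map (fps_of_poly q) = fps_of_poly (map_poly h q).
Proof. by apply: fpsP => n; rewrite /= coef_map. Qed.

End FpsMap.

Lemma fps_map_inj (R S : idomainType) (h : {rmorphism R -> S}) :
  injective h -> injective (fps_map h).
Proof.
move=> h_inj f g eq_fg; apply: fpsP => n; apply: h_inj.
exact: (congr1 (fun k => fps_coef k n) eq_fg).
Qed.

Definition fg_monomial (R : idomainType) i j : fps R := ffps R ^+ i * gfps R ^+ j.

Lemma fps_map_fg_monomial (R S : idomainType) (h : {rmorphism R -> S}) i j :
  fps_map h (fg_monomial R i j) = fg_monomial S i j.
Proof.
rewrite rmorphM !rmorphXn /=; congr (_ ^+ _ * _ ^+ _); apply: fpsP => n;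
exact: rmorph_nat.
Qed.

Lemma fg_monomial_neq0 (R : idomainType) i j : fg_monomial R i j != 0.
Proof.
have neq0 (f : fps R) : fps_coef f 0 = 1 -> f != 0.
  by move=> f1; apply/eqP => f0; move/eqP: f1; rewrite f0 fps_coef0 eq_sym oner_eq0.
rewrite mulf_neq0 // expf_neq0 // neq0 //=.
by rewrite /gnat big_nat1 bin0.
Qed.

(** A relation of bounded degree becomes a scalar relation among the series z^l G_i, to which
    [lin_indep_mod_prime] applies. *)
Lemma fps_coef_relation (R : idomainType) (I : finType) E (d : I -> {poly R})
    (G : I -> fps R) n : (forall i, (size (d i) <= E)%N) ->
  fps_coef (\sum_i fps_of_poly (d i) * G i) n =
    \sum_(x : I * 'I_E) (d x.1)`_(x.2) * fps_coef (fps_of_poly 'X^(x.2) * G x.1) n.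
Proof.
move=> size_d; rewrite fps_coef_sum.
rewrite -(pair_bigA _ (fun i (l : 'I_E) => (d i)`_l * fps_coef (fps_of_poly 'X^l * G i) n)).
apply: eq_bigr => i _.
have {1}-> : d i = \sum_(l < E) ((d i)`_l)%:P * 'X^l.
  under eq_bigr do rewrite mul_polyC; rewrite -(poly_def E (fun l => (d i)`_l)).
  apply/polyP => l; rewrite coef_poly; case: ltnP => // le_El.
  by rewrite nth_default // (leq_trans (size_d i)).
rewrite rmorph_sum mulr_suml fps_coef_sum; apply: eq_bigr => l _.
by rewrite rmorphM -mulrA fps_of_polyC_mul.
Qed.

Lemma fps_of_polyM (R : idomainType) (q1 q2 : {poly R}) :
  fps_of_poly (q1 * q2) = fps_of_poly q1 * fps_of_poly q2.
Proof. exact: rmorphM. Qed.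

Lemma degM (R : idomainType) (q1 q2 : {poly R}) : q1 != 0 -> q2 != 0 ->
  (size (q1 * q2)).-1 = ((size q1).-1 + (size q2).-1)%N.
Proof.
by move=> q1_0 q2_0; rewrite size_mul //; move: q1_0 q2_0; rewrite -!size_poly_gt0; lia.
Qed.

(** * Sections of a relation modulo p *)

Section RelationModPrime.
Variables (I : finType) (e1 e2 : I -> nat) (c : I -> {poly int}).
Variable p : nat.
Hypothesis p_pr : prime p.
Hypothesis rel_c : \sum_i fps_of_poly (c i) * fg_monomial int (e1 i) (e2 i) = 0.

Let p_gt0 : (0 < p)%N. Proof. exact: prime_gt0. Qed.
Let charp : p \in [pchar 'F_p]. Proof. exact: pchar_Fp. Qed.

Local Notation cp i := (map_poly (intr : int -> 'F_p) (c i)).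
Local Notation T i j := (ftrunc 'F_p p ^+ i * gtrunc 'F_p p ^+ j).
Local Notation Q i := (cp i * T (e1 i) (e2 i)).
Local Notation M i := (fg_monomial 'F_p (e1 i) (e2 i)).
Local Notation E1 := (\max_i (size (c i) + e1 i + e2 i))%N.

Lemma fg_monomial_frob i j :
  fg_monomial 'F_p i j = fps_of_poly (T i j) * fps_dil p (fg_monomial 'F_p i j).
Proof.
rewrite /fg_monomial rmorphM !rmorphXn fps_dilM // !fps_dilX //.
by rewrite mulrACA -!exprMn -(ffps_frob charp) -(gfps_frob charp).
Qed.

Lemma relation_mod_prime : \sum_i fps_of_poly (cp i) * M i = 0.
Proof.
have := congr1 (fps_map (intr : {rmorphism int -> 'F_p})) rel_c.
rewrite rmorph0 rmorph_sum; apply: etrans; apply: eq_bigr => i _.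
by rewrite rmorphM /= fps_map_fg_monomial fps_map_poly.
Qed.

(** By [fg_monomial_frob] each monomial is a polynomial times its own dilation, and the dilation
    leaves the section undilated. *)
Lemma relation_sect r : (r < p)%N ->
  \sum_i fps_sect p r (fps_of_poly (Q i)) * M i = 0.
Proof.
move=> lt_rp; have := congr1 (fps_sect p r) relation_mod_prime.
rewrite fps_sect0 fps_sect_sum; apply: etrans; apply: eq_bigr => i _.
rewrite -fps_sect_mul_dil //; congr fps_sect.
by rewrite rmorphM -mulrA -fg_monomial_frob.
Qed.

Let sect_poly r (q : {poly 'F_p}) : {poly 'F_p} := \poly_(n < E1) q`_(n * p + r).

(** The truncations have size at most [p]. As [E1] does not depend on [p], the sections of [Q i]
    have degree bounded independently of [p]. *)
Lemma size_Q i : (size (Q i) <= E1 * p)%N.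
Proof.
have le_E1 : (size (c i) + e1 i + e2 i <= E1)%N := leq_bigmax i.
have size_c : (size (cp i) <= size (c i))%N by apply: size_poly.
have size_f : (size (ftrunc 'F_p p) <= p)%N by apply: size_poly.
have size_g : (size (gtrunc 'F_p p) <= p)%N by apply: size_poly.
have [cp0|cp_neq0] := eqVneq (cp i) 0; first by rewrite cp0 mul0r size_poly0.
have f_neq0 := ftrunc_neq0 charp; have g_neq0 := gtrunc_neq0 charp.
suff : ((size (Q i)).-1 < E1 * p)%N by lia.
rewrite !degM ?mulf_neq0 ?expf_neq0 // !size_exp.
move: cp_neq0; rewrite -size_poly_gt0 => cp_gt0.
have : ((size (ftrunc 'F_p p)).-1 * e1 i <= e1 i * p)%N.
  by rewrite mulnC leq_mul2l; lia.
have : ((size (gtrunc 'F_p p)).-1 * e2 i <= e2 i * p)%N.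
  by rewrite mulnC leq_mul2l; lia.
have := leq_mul le_E1 (leqnn p); have := leq_pmulr (size (c i)) p_gt0.
rewrite !mulnDl; move: (_.-1 * e1 i)%N (_.-1 * e2 i)%N => x y.
move: size_c cp_gt0; clear.
move: (size (cp i)) (size (c i)) (e1 i * p)%N (e2 i * p)%N (E1 * p)%N => a b u w z.
by lia.
Qed.

Lemma fps_sect_Q r i : (r < p)%N ->
  fps_sect p r (fps_of_poly (Q i)) = fps_of_poly (sect_poly r (Q i)).
Proof.
move=> lt_rp; apply: fpsP => n; rewrite /= coef_poly; case: ltnP => // le_n.
by rewrite nth_default // (leq_trans (size_Q i)) //; nia.
Qed.

(* Each section of the relation twisted by Frobenius is again a relation of bounded
   degree; eliminating the [i0] term between it and the original relation gives a
   relation off [i0], which has to vanish. *)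
Lemma relation_proportional i0 :
    (forall a : I * 'I_(E1 + E1) -> 'F_p,
       (forall x, (x.1 == i0) || (c x.1 == 0) -> a x = 0) ->
       (forall n, \sum_x a x * (fps_coef (fps_of_poly 'X^(x.2)
          * fg_monomial int (e1 x.1) (e2 x.1)) n)%:~R = 0) -> forall x, a x = 0) ->
  forall i, Q i * (cp i0 \Po 'X^p) = Q i0 * (cp i \Po 'X^p).
Proof.
move=> indep i; apply: (@fps_of_poly_inj 'F_p).
rewrite [LHS]fps_of_polyM [RHS]fps_of_polyM -!fps_dil_poly //.
(* Section [r] strips the dilations and leaves the vanishing of the cross product [d i] below. *)
apply: (fps_sectP p_gt0) => r lt_rp; rewrite !fps_sect_mul_dil // !fps_sect_Q //.
pose d j := sect_poly r (Q j) * cp i0 - sect_poly r (Q i0) * cp j.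
have size_c j : (size (cp j) <= E1)%N.
  have le_E1 : (size (c j) + e1 j + e2 j <= E1)%N := leq_bigmax j.
  by apply: leq_trans (size_poly _ _) (leq_trans _ le_E1); rewrite -addnA leq_addr.
have size_sect j : (size (sect_poly r (Q j)) <= E1)%N by apply: size_poly.
have size_d j : (size (d j) <= E1 + E1)%N.
  apply: leq_trans (size_polyD _ _) _; rewrite size_polyN geq_max.
  by apply/andP; split; apply: leq_trans (size_polyMleq _ _) _;
    apply: leq_trans (leq_pred _) _; apply: leq_add.
have d_rel : \sum_j fps_of_poly (d j) * M j = 0.
  transitivity (fps_of_poly (cp i0) * (\sum_j fps_sect p r (fps_of_poly (Q j)) * M j)
    - fps_of_poly (sect_poly r (Q i0)) * \sum_j fps_of_poly (cp j) * M j).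
    rewrite !mulr_sumr -sumrB; apply: eq_bigr => j _.
    by rewrite fps_sect_Q // /d rmorphB !rmorphM /=; ring.
  by rewrite relation_sect // relation_mod_prime !mulr0 subrr.
suff d0 : d i = 0 by apply/eqP; rewrite -!fps_of_polyM -subr_eq0 -rmorphB -/(d i) d0 rmorph0.
pose a (x : I * 'I_(E1 + E1)) := (d x.1)`_(x.2).
have a0 : forall x, a x = 0.
  apply: indep => [x /orP[/eqP xi|/eqP cx0]|n]; rewrite /a.
  - by rewrite /d xi subrr coef0.
  - rewrite /d cx0 map_poly0 !mul0r mulr0 subr0.
    rewrite (_ : sect_poly r 0 = 0) ?mul0r ?coef0 //.
    by apply/polyP => l; rewrite coef_poly !coef0 if_same.
  rewrite -[RHS](fps_coef0 _ n) -d_rel (fps_coef_relation _ _ size_d); apply: eq_bigr => x _.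
  congr (_ * _); rewrite -(fps_map_fg_monomial (intr : {rmorphism int -> 'F_p})).
  by rewrite -(map_polyXn (intr : {rmorphism int -> 'F_p})) -fps_map_poly -rmorphM.
apply/polyP => l; rewrite coef0; have [lt_l|le_l] := ltnP l (E1 + E1).
  exact: (a0 (i, Ordinal lt_l)).
by rewrite nth_default // (leq_trans (size_d i)).
Qed.

End RelationModPrime.

Lemma degree_relation (I : finType) (e1 e2 : I -> nat) (c : I -> {poly int}) i0 i1 :
    \sum_i fps_of_poly (c i) * fg_monomial int (e1 i) (e2 i) = 0 ->
    (forall d : I -> {poly int}, (forall i, (i == i0) || (c i == 0) -> d i = 0) ->
       \sum_i fps_of_poly (d i) * fg_monomial int (e1 i) (e2 i) = 0 ->
       forall i, d i = 0) ->
    c i0 != 0 -> c i1 != 0 ->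
  exists B, forall p, prime p -> (B < p)%N ->
    let df := (size (ftrunc 'F_p p)).-1 in let dg := (size (gtrunc 'F_p p)).-1 in
    ((size (c i1)).-1 + (df * e1 i1 + dg * e2 i1) + (size (c i0)).-1 * p =
     (size (c i0)).-1 + (df * e1 i0 + dg * e2 i0) + (size (c i1)).-1 * p)%N.
Proof.
move=> rel_c indep c0 c1; set E := (\max_i (size (c i) + e1 i + e2 i))%N.
(* On these indices [indep] gives linear independence over the integers. *)
pose A := [set x : I * 'I_(E + E) | (x.1 != i0) && (c x.1 != 0)].
pose v (x : I * 'I_(E + E)) n :=
  fps_coef (fps_of_poly 'X^(x.2) * fg_monomial int (e1 x.1) (e2 x.1)) n.
have [a a_supp a_rel x|B BP] := @lin_indep_mod_prime _ A v.
  pose d i : {poly int} := \poly_(l < E + E) (if insub l is Some l' then a (i, l') else 0).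
  have coef_d i (l : 'I_(E + E)) : (d i)`_l = a (i, l).
    by rewrite coef_poly ltn_ord valK.
  have d0 : forall i, d i = 0.
    apply: indep => [i i_supp|].
      apply/polyP => l; rewrite coef0; have [lt_l|le_l] := ltnP l (E + E).
        by rewrite (coef_d i (Ordinal lt_l)) a_supp // inE negb_and !negbK.
      by rewrite nth_default // (leq_trans (size_poly _ _)).
    apply: fpsP => n; rewrite fps_coef0 -[RHS](a_rel n).
    rewrite (@fps_coef_relation _ _ (E + E)); last by move=> i; apply: size_poly.
    by apply: eq_bigr => -[i l] _; rewrite coef_d.
  by case: x => i l; rewrite -coef_d d0 coef0.
(* Exceeding the leading coefficients ensures that reduction mod [p] preserves both degrees. *)
exists (maxn B (maxn `|lead_coef (c i0)| `|lead_coef (c i1)|)) => p p_pr.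
rewrite !gtn_max => /and3P[lt_B lt_0 lt_1] df dg.
have charp := pchar_Fp p_pr.
have size_c i : c i != 0 -> (`|lead_coef (c i)| < p)%N ->
    size (map_poly (intr : int -> 'F_p) (c i)) = size (c i).
  by move=> ci lt_i; rewrite size_map_poly_id0 // intr_Fp_neq0 ?lead_coef_eq0.
have prop := @relation_proportional I e1 e2 c p p_pr rel_c i0 _ i1.
have {prop} : map_poly intr (c i1) * (ftrunc 'F_p p ^+ e1 i1 * gtrunc 'F_p p ^+ e2 i1)
      * (map_poly intr (c i0) \Po 'X^p)
    = map_poly intr (c i0) * (ftrunc 'F_p p ^+ e1 i0 * gtrunc 'F_p p ^+ e2 i0)
      * (map_poly intr (c i1) \Po 'X^p) :> {poly 'F_p}.
  apply: prop => a a_supp; apply: (BP p p_pr lt_B) => x xA; apply: a_supp.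
  by move: xA; rewrite inE negb_and !negbK.
move=> /(congr1 (fun q : {poly 'F_p} => (size q).-1)).
have f_neq0 := ftrunc_neq0 charp; have g_neq0 := gtrunc_neq0 charp.
have neq0 i : c i != 0 -> (`|lead_coef (c i)| < p)%N ->
    map_poly (intr : int -> 'F_p) (c i) != 0.
  by move=> ci lt_i; rewrite -size_poly_eq0 size_c // size_poly_eq0.
have comp_neq0 (q : {poly 'F_p}) : q != 0 -> q \Po 'X^p != 0.
  rewrite -!lead_coef_eq0 lead_coef_comp ?size_polyXn ?ltnS ?prime_gt0 //.
  by rewrite lead_coefXn expr1n mulr1.
rewrite !degM ?mulf_neq0 ?expf_neq0 ?comp_neq0 ?neq0 // !size_exp !size_comp_poly.
by rewrite size_polyXn !size_c.
Qed.

(** The degree equations at the two primes are incompatible. At [q] the degrees [df] and [dg] stay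
    unknown: the first is multiplied by a = 0, and the second is excluded mod 3. *)
Lemma degree_arith (a0 a1 b0 b1 d0 d1 p sf sg q df dg : nat) :
    a0 <> a1 \/ b0 <> b1 -> (p %% 12 = 7)%N -> (q %% 6 = 5)%N ->
    (4 * sf = p + 1)%N -> (6 * sg = 5 * p + 1)%N ->
    (d1 + (sf.-1 * a1 + sg.-1 * b1) + d0 * p
       = d0 + (sf.-1 * a0 + sg.-1 * b0) + d1 * p)%N ->
    (d1 + (df * a1 + dg * b1) + d0 * q = d0 + (df * a0 + dg * b0) + d1 * q)%N ->
  (6 * (a0 + a1).+1 < p)%N -> False.
Proof.
move=> neq p12 q6 f_p g_p Ep Eq lt_p.
pose t := (p %/ 12)%N; have pE : p = (12 * t + 7)%N by rewrite /t; lia.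
have qE : q = (6 * (q %/ 6) + 5)%N by lia.
move: (q %/ 6)%N qE => s qE.
have sfE : sf = (3 * t + 2)%N by lia.
have sgE : sg = (10 * t + 6)%N by lia.
clearbody t; move: neq Ep Eq lt_p; rewrite qE {}sfE {}sgE pE !addnS /= !addn0.
move=> {p12 q6 f_p g_p pE qE} neq Ep Eq lt_p.
pose a : int := a1%:Z - a0%:Z; pose b : int := b1%:Z - b0%:Z.
pose d : int := d1%:Z - d0%:Z; pose u : int := 10 * b - 12 * d + 3 * a.
(* Twice the equation a(3t + 1) + b(10t + 5) = d(12t + 6). The bound on [p] gives |a| < 2t + 1,
   which forces u = 0. *)
have key : (2 * t%:Z + 1) * u = a by rewrite /u /a /b /d; lia.
have u0 : u = 0.
  have t_gt0 : 0 < 2 * t%:Z + 1 :> int by lia.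
  have : `|a| < 2 * t%:Z + 1 by rewrite /a; lia.
  by rewrite -key normrM (gtr0_norm t_gt0) gtr_pMr //; lia.
have a0E : a = 0 by rewrite -key u0 mulr0.
have key2 : dg%:Z * b = d * (6 * s%:Z + 4).
  by have : df%:Z * a = 0; [rewrite a0E mulr0|rewrite /a /b /d; lia].
have b5 : 5 * b = 6 * d by move: u0; rewrite /u a0E; lia.
have b0E : b <> 0 by move: a0E neq; rewrite /a /b; lia.
(* Eliminate d between [key2] and [b5]; since 3 does not divide 10, the second factor cannot be
   zero. *)
have key3 : b * (3 * dg%:Z - 15 * s%:Z - 10) = 0 by lia.
have : 3 * dg%:Z - 15 * s%:Z - 10 = 0 by move/eqP: key3; rewrite mulf_eq0 => /orP[]/eqP.
lia.
Qed.

Lemma fg_relation_trivial (I : finType) (e1 e2 : I -> nat) (c : I -> {poly int}) :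
    (forall i j, e1 i = e1 j -> e2 i = e2 j -> i = j) ->
    \sum_i fps_of_poly (c i) * fg_monomial int (e1 i) (e2 i) = 0 ->
  forall i, c i = 0.
Proof.
move=> e_inj; have [k] := ubnP #|[set i | c i != 0]|.
elim: k c => // k IHk c le_k rel_c i0; apply/eqP/negPn/negP => c0.
(* Such a relation lacks the term [i0] and so has fewer terms than [c]; the induction hypothesis
   applies. *)
have indep (d : I -> {poly int}) : (forall i, (i == i0) || (c i == 0) -> d i = 0) ->
    \sum_i fps_of_poly (d i) * fg_monomial int (e1 i) (e2 i) = 0 -> forall i, d i = 0.
  move=> d_supp; apply: IHk; rewrite -ltnS (leq_trans _ le_k) // ltnS.
  apply/proper_card/properP; split.
    apply/subsetP => i; rewrite !inE; apply: contra => ci.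
    by rewrite d_supp // ci orbT.
  by exists i0; rewrite !inE // d_supp ?eqxx.
(* A single nonzero term cannot vanish, because power series form a domain. *)
have [i1 ne_i c1] : exists2 i1, i1 != i0 & c i1 != 0.
  apply: contrapT => no_i1.
  move: rel_c; rewrite (bigD1 i0) //= big1 => [|i ne_i]; last first.
    have [-> |ci] := eqVneq (c i) 0; first by rewrite rmorph0 mul0r.
    by case: no_i1; exists i.
  rewrite addr0 => /eqP; rewrite mulf_eq0 (negbTE (fg_monomial_neq0 _ _ _)) orbF.
  by rewrite -(rmorph0 (@fps_of_poly int)) (inj_eq (@fps_of_poly_inj _)) (negbTE c0).
have [B BP] := degree_relation rel_c indep c0 c1.
have [p [p_pr lt_p p12]] := prime_7_mod_12 (maxn B (6 * (e1 i0 + e1 i1).+1)).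
have [q [q_pr lt_q q6]] := prime_5_mod_6 (maxn B 1).
move: lt_p lt_q; rewrite !gtn_max => /andP[lt_Bp lt_p] /andP[lt_Bq lt_q].
have f_p := size_ftrunc (pchar_Fp p_pr); have g_p := size_gtrunc (pchar_Fp p_pr).
have := BP p p_pr lt_Bp; have := BP q q_pr lt_Bq => /=.
have {f_p} : (4 * size (ftrunc 'F_p p) = p + 1)%N.
  by apply: f_p; rewrite -(@modn_dvdm 12) ?p12.
have {g_p} : (6 * size (gtrunc 'F_p p) = 5 * p + 1)%N.
  by apply: g_p; rewrite -(@modn_dvdm 12) ?p12.
move: (size (gtrunc 'F_p p)) (size (ftrunc 'F_p p)) => sg sf g_p f_p.
move: (size (gtrunc 'F_q q)).-1 (size (ftrunc 'F_q q)).-1 => dgq dfq.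
move: (size (c i0)).-1 (size (c i1)).-1 => d0 d1 Eq Ep.
have neq : e1 i0 <> e1 i1 \/ e2 i0 <> e2 i1.
  apply: contrapT => /not_orP[/contrapT e1E /contrapT e2E].
  by rewrite (e_inj _ _ e1E e2E) eqxx in ne_i.
apply: (degree_arith neq p12 q6 f_p g_p Ep Eq); lia.
Qed.

(** * Clearing denominators *)

Lemma ratfun_common_denominator (I : finType) (x : I -> {fraction {poly rat}}) :
  exists D (c : I -> {poly int}), D != 0 /\
    forall i, x i = tofrac (map_poly intr (c i)) / tofrac D.
Proof.
pose den i := \d_(repr (x i)); pose num i := \n_(repr (x i)).
have den0 i : den i != 0 by apply: denom_ratioP.
have prod_neq0 (R : idomainType) (F : I -> R) (Q : pred I) :
    (forall i, F i != 0) -> \prod_(i | Q i) F i != 0.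
  by move=> F0; apply/prodf_neq0 => i _.
pose n i := num i * \prod_(j | j != i) den j.
have scale i : exists q : {poly int}, exists2 a : int, a != 0 &
    n i = a%:~R^-1 *: map_poly intr q.
  by have [q [a a0 E]] := rat_poly_scale (n i); exists q, a.
have [q /fin_all_exists2[a a0 nE]] := fin_all_exists scale.
pose N : int := \prod_i a i.
(* [n i] is the numerator over the product of all [den], and equals [q i] divided by the integer
   [a i]; scaling by the product [N] of all [a i] makes every numerator integral. *)
exists (N%:~R *: \prod_i den i), (fun i => (\prod_(j | j != i) a j) *: q i); split.
  by rewrite scaler_eq0 intr_eq0 negb_or !prod_neq0.
move=> i; have N0 : N%:~R != 0 :> rat by rewrite intr_eq0 prod_neq0.
have -> : map_poly intr ((\prod_(j | j != i) a j) *: q i) = N%:~R *: n i.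
  rewrite map_polyZ nE scalerA [N](bigD1 i) //= intrM mulrAC mulfV ?intr_eq0 //.
  by rewrite mul1r.
rewrite [LHS]frac_numden -/(num i) -/(den i); apply/eqP.
rewrite eqr_div ?tofrac_eq0 ?scaler_eq0 ?negb_or ?N0 ?prod_neq0 //.
rewrite -!tofracM tofrac_eq /n -scalerAl -scalerAr [X in _ * X](bigD1 i) //=.
by rewrite -mulrA [X in _ == _ *: (_ * X)]mulrC.
Qed.

Lemma fg_algebraically_independent :
  algebraically_independent (@laurent_of_ratfun rat)
    [:: tofrac (ffps rat); tofrac (gfps rat)].
Proof.
move=> P; set h := fun i => _.
pose I : finType := 'X_{1..2 < msize P}.
pose e1 (m : I) := (m : 'X_{1..2}) ord0.
pose e2 (m : I) := (m : 'X_{1..2}) (lift ord0 ord0).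
rewrite (mmapE _ (leqnn (msize P))).
have [D [c [D0 xE]]] := ratfun_common_denominator (fun m : I => P@_m).
have monoE (m : I) : mmap1 h m = tofrac (fg_monomial rat (e1 m) (e2 m)).
  by rewrite /mmap1 !big_ord_recl big_ord0 mulr1 tofracM !tofracXn.
have termE (m : I) : laurent_of_ratfun P@_m * mmap1 h m =
    tofrac (fps_map intr (fps_of_poly (c m) * fg_monomial int (e1 m) (e2 m)))
      / tofrac (fps_of_poly D).
  rewrite xE laurent_of_ratfun_div // monoE mulrAC -tofracM [fps_map _ (_ * _)]rmorphM /=.
  by rewrite fps_map_poly fps_map_fg_monomial.
(* The common denominator drops out, and the relation descends to integer power series by
   injectivity of [fps_map]. *)
rewrite (eq_bigr _ (fun m _ => termE m)) -mulr_suml => /eqP.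
rewrite mulf_eq0 invr_eq0 (negbTE (fps_of_poly_frac_neq0 D0)) orbF.
rewrite -(rmorph_sum (@tofrac (fps rat))) /= tofrac_eq0 -rmorph_sum /=.
move/eqP; rewrite -[RHS](rmorph0 (fps_map (intr : {rmorphism int -> rat}))).
move=> /(fps_map_inj (@intr_inj rat)) rel.
have c0 : forall m, c m = 0.
  apply: fg_relation_trivial rel => m m' e1E e2E; apply/val_inj/mnmP => i.
  by case: i => [[|[|//]] lt_i]; rewrite (bool_irrelevance lt_i isT);
    [move: e1E | move: e2E]; rewrite /e1 /e2 /=; congr (_ = _); congr (_ _); apply: val_inj.
apply/mpolyP => m; rewrite mcoeff0.
have [lt_m|le_m] := ltnP (mdeg m) (msize P).
  by rewrite (xE (BMultinom lt_m)) c0 map_poly0 tofrac0 mul0r.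
by apply/memN_msupp_eq0/negP => /msize_mdeg_lt; rewrite ltnNge le_m.
Qed.

Lemma fnat_fact n : ((4 * n)`! = fnat n * ((2 * n)`! * n`! ^ 2))%N.
Proof.
have E (k : nat) : ('C(k.*2, k) * (k`! * k`!) = (k.*2)`!)%N.
  by have := @bin_fact k.*2 k; rewrite -addnn addnK; apply; apply: leq_addr.
have -> : (4 * n = n.*2.*2)%N by lia.
by rewrite mul2n -(E n.*2) -{2}(E n) /fnat -mulnn; ring.
Qed.

Theorem theorem6p8 :
  algebraically_independent (@laurent_of_ratfun rat)
    [:: tofrac (FPS (fun n : nat =>
         ((4 * n)`!)%:R / (((2 * n)`!)%:R * (n`!)%:R ^+ 2) : rat));
        tofrac (FPS (fun n : nat =>
         (\sum_(0 <= k < n.+1) 'C(n, k) ^ 6)%N%:R : rat))].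
Proof.
have -> : FPS (fun n : nat => ((4 * n)`!)%:R / (((2 * n)`!)%:R * (n`!)%:R ^+ 2) : rat)
    = ffps rat.
  apply: fpsP => n /=; rewrite fnat_fact natrM natrM natrX mulfK //.
  by rewrite mulf_neq0 ?expf_neq0 // pnatr_eq0 -lt0n fact_gt0.
exact: fg_algebraically_independent.
Qed.
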